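(* Consider the second order Lagrangian $L(u,u',u'')=\left(\frac{u''}{u'}\right)^2$ and the functional $\mathcal{I}_L[u]=\int_{t_0}^{t_1}\left(\frac{u''}{u'}\right)^2dt$ on smooth functions $u\colon[t_0,t_1]\to\mathbb{R}$ with $u'$ nowhere zero. The Euler--Lagrange equation associated to $L$ (that is, the equation characterizing the critical points $u$ of $\mathcal{I}_L$ with respect to the class of all variations whose variational vector field $v$ satisfies $v(t_i)=v'(t_i)=0$ for $i=0,1$) takes the form $$\frac{u''''}{u'}=-3\frac{(u'')^3}{(u')^3}+4\frac{u'''u''}{(u')^2}.$$ Moreover, any solution $u$ of the equation $S(u)=0$, where $S(u)=\frac{u'''}{u'}-\frac32\left(\frac{u''}{u'}\right)^2$, satisfies this fourth order equation.
   Context: Here $[t_0,t_1]\subset\mathbb{R}$ is a fixed interval and primes denote $d/dt$. A variation of $u\colon[t_0,t_1]\to\mathbb{R}$ is a smooth map $\varphi\colon[t_0,t_1]\times[-1,1]\to\mathbb{R}$ with $\varphi(t,0)=u(t)$; its variational vector field along $u$ is $v(t)=\frac{\partial}{\partial s}\varphi(t,s)|_{s=0}$. The variation of a functional $\mathcal{I}$ with respect to $v$ is $\delta_v\mathcal{I}[u]=\frac{d}{ds}\mathcal{I}[\varphi(\cdot,s)]|_{s=0}$ (only $s$ near $0$ matters, so that $\partial_t\varphi(\cdot,s)$ is nowhere zero). A function $u$ is a critical point of $\mathcal{I}$ with respect to a class of admissible variations if $\delta_v\mathcal{I}[u]=0$ for all $v$ in the class. $S(u)$ is the Schwarzian derivative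 of $u$. *)

(* Defs.v *)
From Stdlib Require Import Reals.
From Coquelicot Require Import Coquelicot.

Open Scope R_scope.

(* C^infinity on a closed interval [a, b] or a closed rectangle
   [a, b] x [c, d] means, as usual, C^infinity on an open neighbourhood of it;
   the derivatives at boundary points are then ordinary two-sided ones and are
   determined by the restriction to the closed set. *)
Definition smooth_on (a b : R) (f : R -> R) : Prop :=
  forall t, a <= t <= b -> locally t (fun x => forall n, ex_derive_n f n x).

Definition smooth_on_rect (a b c d : R) (f : R -> R -> R) : Prop :=
  forall t s, a <= t <= b -> c <= s <= d ->
    locally_2d (fun x y => forall n, ex_diff_n f n x y) t s.

Definition variation (t0 t1 : R) (u : R -> R) (phi : R -> R -> R) : Prop :=
  smooth_on_rect t0 t1 (-1) 1 phi /\
  forall t, t0 <= t <= t1 -> phi t 0 = u t.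

Definition variational_field (phi : R -> R -> R) (t : R) : R :=
  Derive (fun s => phi t s) 0.

(* [I] is a functional and [adm] the class of admissible variational vector
   fields. [is_derive] asks that the derivative at 0 exist and vanish, whereas
   [Derive] also has a (meaningless) value where there is no derivative. *)
Definition critical_point (t0 t1 : R) (I : (R -> R) -> R)
    (adm : (R -> R) -> Prop) (u : R -> R) : Prop :=
  forall phi, variation t0 t1 u phi -> adm (variational_field phi) ->
    is_derive (fun s => I (fun t => phi t s)) 0 0.

Definition fixed_to_first_order (t0 t1 : R) (v : R -> R) : Prop :=
  v t0 = 0 /\ v t1 = 0 /\ Derive v t0 = 0 /\ Derive v t1 = 0.

Definition action (t0 t1 : R) (L : R -> R -> R -> R) (f : R -> R) : R :=
  RInt (fun t => L (f t) (Derive f t) (Derive_n f 2 t)) t0 t1.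

Definition Lag (u0 u1 u2 : R) : R := (u2 / u1) ^ 2.

Definition schwarzian (u : R -> R) (t : R) : R :=
  Derive_n u 3 t / Derive u t - 3 / 2 * (Derive_n u 2 t / Derive u t) ^ 2.

Definition fourth_order_eq (u : R -> R) (t : R) : Prop :=
  Derive_n u 4 t / Derive u t =
    - 3 * ((Derive_n u 2 t) ^ 3 / (Derive u t) ^ 3)
    + 4 * ((Derive_n u 3 t * Derive_n u 2 t) / (Derive u t) ^ 2).

(* Main.v *)
(** Differentiating under the integral sign and integrating by parts twice, the
    variation of the action along [v] with [v] and [v'] vanishing at the ends is
    the integral of [2 E v / u'^4], where
    [E = u'''' u'^2 - 4 u''' u'' u' + 3 u''^3]. The fourth order equation says
    [E = 0], so its solutions are critical. Conversely no bump function is needed: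
    [v = (t - t0)^2 (t1 - t)^2 E] is itself admissible, and the variation along it
    is the integral of a nonnegative continuous function that vanishes in the
    interior only where [E] does. Finally the derivative of the Schwarzian is
    [E / u'^3]. *)
Require Import Defs.
From Stdlib Require Import Reals.
From Stdlib Require Import Lra Lia Wf_nat Classical ClassicalEpsilon.
From Coquelicot Require Import Coquelicot.
Open Scope R_scope.

(** * Calculus of smooth functions of one variable *)

(** Pointwise form of [smooth_on]. One neighbourhood serves all orders at once, which makes the
    property open and stable under [Derive]. *)
Definition smooth_at (f : R -> R) (x : R) : Prop :=
  locally x (fun y => forall n, ex_derive_n f n y).

(** [Derive_n] adds derivatives on the outside. This lemma and the next strip or restore the
    innermost one, as the inductions on the order below require. *)
Lemma ex_derive_n_Derive (f : R -> R) (n : nat) (x : R) :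
  ex_derive_n f (S n) x -> ex_derive_n (Derive f) n x.
Proof.
  destruct n as [|n]; [easy|].
  intros H. apply (ex_derive_ext (Derive_n f (S n))); [|exact H].
  intros t. replace (S n) with (n + 1)%nat by lia.
  symmetry. exact (Derive_n_comp f n 1 t).
Qed.

Lemma ex_derive_n_of_Derive (f : R -> R) (n : nat) (x : R) :
  ex_derive f x -> ex_derive_n (Derive f) n x -> ex_derive_n f (S n) x.
Proof.
  destruct n as [|n]; [easy|].
  intros _ H. apply (ex_derive_ext (Derive_n (Derive f) n)); [|exact H].
  intros t. replace (S n) with (n + 1)%nat by lia.
  exact (Derive_n_comp f n 1 t).
Qed.

Lemma smooth_at_locally (f : R -> R) (x : R) :
  smooth_at f x -> locally x (smooth_at f).
Proof. apply locally_locally. Qed.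

Lemma smooth_at_ext_loc (f g : R -> R) (x : R) :
  locally x (fun y => f y = g y) -> smooth_at f x -> smooth_at g x.
Proof.
  intros E Hf. apply locally_locally in E.
  generalize (filter_and _ _ E Hf). unfold smooth_at. apply filter_imp.
  intros y [Ey Hy] n. exact (ex_derive_n_ext_loc f g n y Ey (Hy n)).
Qed.

Lemma smooth_at_Derive (f : R -> R) (x : R) :
  smooth_at f x -> smooth_at (Derive f) x.
Proof.
  unfold smooth_at. apply filter_imp. intros y H n. apply ex_derive_n_Derive, H.
Qed.

Lemma smooth_at_Derive_n (f : R -> R) (n : nat) (x : R) :
  smooth_at f x -> smooth_at (Derive_n f n) x.
Proof.
  intros H. induction n as [|n IH]; [exact H|]. exact (smooth_at_Derive _ x IH).
Qed.

Lemma smooth_at_ex_derive (f : R -> R) (x : R) : smooth_at f x -> ex_derive f x.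
Proof. intros H. exact (locally_singleton _ _ H 1%nat). Qed.

Lemma smooth_at_continuous (f : R -> R) (x : R) : smooth_at f x -> continuous f x.
Proof. intros H. now apply (ex_derive_continuous f), smooth_at_ex_derive. Qed.

Lemma smooth_at_plus (f g : R -> R) (x : R) :
  smooth_at f x -> smooth_at g x -> smooth_at (fun y => f y + g y) x.
Proof.
  intros Hf Hg. apply locally_locally in Hf. apply locally_locally in Hg.
  generalize (filter_and _ _ Hf Hg). unfold smooth_at. apply filter_imp. intros y [Fy Gy] n.
  apply ex_derive_n_plus; [revert Fy|revert Gy]; apply filter_imp; auto.
Qed.

Lemma smooth_at_const (c x : R) : smooth_at (fun _ => c) x.
Proof. unfold smooth_at. apply filter_forall. intros y n. apply ex_derive_n_const. Qed.

Lemma smooth_at_id (x : R) : smooth_at (fun y => y) x.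
Proof.
  unfold smooth_at. apply filter_forall. intros y n.
  apply (ex_derive_n_ext (fun z => z ^ 1)); [intros; ring|apply ex_derive_n_pow].
Qed.

(** By the Leibniz rule the derivative of a product is a sum of two products of smooth functions, so
    induction on the order applies. It is strong induction because [ex_derive_n_plus] asks for all
    orders up to the given one near the point. *)
Lemma smooth_at_mult (f g : R -> R) (x : R) :
  smooth_at f x -> smooth_at g x -> smooth_at (fun y => f y * g y) x.
Proof.
  intros Hf Hg.
  unfold smooth_at. apply (filter_imp (fun y => smooth_at f y /\ smooth_at g y));
    [|apply filter_and; now apply smooth_at_locally].
  intros y Hy n. revert f g x Hf Hg y Hy.
  induction n as [n IH] using lt_wf_ind.
  intros f g x _ _ y [Fy Gy]. destruct n as [|n]; [easy|].
  apply ex_derive_n_of_Derive.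
  { apply (ex_derive_mult f g); now apply smooth_at_ex_derive. }
  apply (ex_derive_n_ext_loc (fun z => Derive f z * g z + f z * Derive g z)).
  { generalize (filter_and _ _ (smooth_at_locally f y Fy) (smooth_at_locally g y Gy)).
    apply filter_imp. intros z [Fz Gz]. symmetry.
    apply Derive_mult; now apply smooth_at_ex_derive. }
  generalize (filter_and _ _ (smooth_at_locally f y Fy) (smooth_at_locally g y Gy)).
  intros FG. apply ex_derive_n_plus; revert FG; apply filter_imp;
    intros z [Fz Gz] k Hk.
  - apply (IH k ltac:(lia) (Derive f) g z); auto using smooth_at_Derive.
  - apply (IH k ltac:(lia) f (Derive g) z); auto using smooth_at_Derive.
Qed.

Lemma smooth_at_pow (f : R -> R) (n : nat) (x : R) :
  smooth_at f x -> smooth_at (fun y => f y ^ n) x.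
Proof.
  intros Hf. induction n as [|n IH]; [exact (smooth_at_const 1 x)|].
  exact (smooth_at_mult f _ x Hf IH).
Qed.

(** * Calculus of smooth functions of two variables *)

Definition smooth2_at (f : R -> R -> R) (x y : R) : Prop :=
  locally_2d (fun u v => forall n, ex_diff_n f n u v) x y.

Definition d1 (f : R -> R -> R) (x y : R) : R := Derive (fun z => f z y) x.
Definition d2 (f : R -> R -> R) (x y : R) : R := Derive (fun z => f x z) y.

Lemma locally_2d_mono (P Q : R -> R -> Prop) (x y : R) :
  (forall u v, P u v -> Q u v) -> locally_2d P x y -> locally_2d Q x y.
Proof. intros H. apply locally_2d_impl, locally_2d_forall, H. Qed.

Lemma smooth2_at_locally (f : R -> R -> R) (x y : R) :
  smooth2_at f x y -> locally_2d (smooth2_at f) x y.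
Proof.
  intros H. refine (locally_2d_impl_strong _ _ x y _ H).
  apply locally_2d_forall. auto.
Qed.

Lemma smooth2_at_d1 (f : R -> R -> R) (x y : R) :
  smooth2_at f x y -> smooth2_at (d1 f) x y.
Proof.
  apply locally_2d_mono. intros u v H n. apply ex_diff_n_deriv_aux1, H.
Qed.

Lemma smooth2_at_d2 (f : R -> R -> R) (x y : R) :
  smooth2_at f x y -> smooth2_at (d2 f) x y.
Proof.
  apply locally_2d_mono. intros u v H n. apply ex_diff_n_deriv_aux2, H.
Qed.

Lemma smooth2_at_continuity (f : R -> R -> R) (x y : R) :
  smooth2_at f x y -> continuity_2d_pt f x y.
Proof. intros H. exact (proj1 (locally_2d_singleton _ _ _ H 0%nat)). Qed.

Lemma smooth2_at_ex_d1 (f : R -> R -> R) (x y : R) :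
  smooth2_at f x y -> ex_derive (fun z => f z y) x.
Proof. intros H. apply (locally_2d_singleton _ _ _ H 1%nat). Qed.

Lemma smooth2_at_ex_d2 (f : R -> R -> R) (x y : R) :
  smooth2_at f x y -> ex_derive (fun z => f x z) y.
Proof. intros H. apply (locally_2d_singleton _ _ _ H 1%nat). Qed.

Lemma smooth2_at_Schwarz (f : R -> R -> R) (x y : R) :
  smooth2_at f x y -> d1 (d2 f) x y = d2 (d1 f) x y.
Proof.
  intros H. apply Schwarz.
  - generalize (smooth2_at_locally f x y H). apply locally_2d_mono.
    intros u v Huv. repeat split.
    + now apply smooth2_at_ex_d1.
    + now apply smooth2_at_ex_d2.
    + now apply (smooth2_at_ex_d1 (d2 f)), smooth2_at_d2.
    + now apply (smooth2_at_ex_d2 (d1 f)), smooth2_at_d1.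
  - now apply (smooth2_at_continuity (d1 (d2 f))), smooth2_at_d1, smooth2_at_d2.
  - now apply (smooth2_at_continuity (d2 (d1 f))), smooth2_at_d2, smooth2_at_d1.
Qed.

(** The derivative of a slice of [f] is by definition the same slice of [d1 f], which is again
    smooth; induction on the order does the rest. *)
Lemma smooth2_at_slice (f : R -> R -> R) (x y : R) :
  smooth2_at f x y -> smooth_at (fun z => f z y) x.
Proof.
  intros H.
  generalize (locally_2d_1d_const_y _ _ _ (smooth2_at_locally f x y H)).
  unfold smooth_at. apply filter_imp. clear x H. intros x H n. revert f x H.
  induction n as [|n IH]; intros f x H; [easy|].
  apply ex_derive_n_of_Derive; [now apply smooth2_at_ex_d1|].
  now apply (IH (d1 f)), smooth2_at_d1.
Qed.

(* Both partial derivatives of an affine family in [v] are again of that form. *)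
Lemma smooth2_at_affine (A B : R -> R) (x y : R) :
  smooth_at A x -> smooth_at B x -> smooth2_at (fun u v => A u + v * B u) x y.
Proof.
  intros HA HB.
  assert (L : locally x (fun u => smooth_at A u /\ smooth_at B u))
    by (apply filter_and; now apply smooth_at_locally).
  destruct L as [d Hd]. exists d. intros u v Hu _ n.
  destruct (Hd u Hu) as [Au Bu]. clear x y HA HB d Hd Hu. revert A B v Au Bu.
  induction n as [|n IH]; intros A B v Au Bu.
  all: assert (C : continuity_2d_pt (fun u v => A u + v * B u) u v).
  1, 3: apply continuity_2d_pt_plus; [|apply continuity_2d_pt_mult];
    [apply (continuity_1d_2d_pt_comp A (fun x _ => x))
    |apply continuity_2d_pt_id2
    |apply (continuity_1d_2d_pt_comp B (fun x _ => x))];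
    try apply continuity_2d_pt_id1;
    now apply continuity_pt_filterlim, smooth_at_continuous.
  { now split. }
  assert (L : locally u (fun x => smooth_at A x /\ smooth_at B x))
    by (apply filter_and; now apply smooth_at_locally).
  split; [exact C|split; [|split; [|split]]].
  - apply smooth_at_ex_derive in Au, Bu. now auto_derive.
  - now auto_derive.
  - apply ex_diff_n_ext_loc with (fun x y => Derive A x + y * Derive B x);
      [|now apply IH; apply smooth_at_Derive].
    destruct L as [d Hd]. exists d. intros x y Hx _.
    destruct (Hd x Hx) as [Ax Bx]. symmetry. apply is_derive_unique.
    apply smooth_at_ex_derive in Ax, Bx. auto_derive; [easy|].
    change (fun x : R => A x) with A. change (fun x : R => B x) with B. ring.
  - apply ex_diff_n_ext_loc with (fun x y => B x + y * 0);
      [|apply (IH B (fun _ => 0)); [easy|apply smooth_at_const]].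
    apply locally_2d_forall. intros x y. symmetry.
    apply is_derive_unique. auto_derive; [easy|ring].
Qed.

(** * Differentiation under the integral sign *)

(** The tube lemma: compactness of [a, b] gives a single width in the second variable that works for
    every [t]. *)
Lemma locally_2d_tube (P : R -> R -> Prop) (a b s : R) :
  (forall t, a <= t <= b -> locally_2d P t s) ->
  locally s (fun y => forall t, a <= t <= b -> P t y).
Proof.
  intros H.
  assert (C : forall t, exists d : posreal, a <= t <= b ->
    forall u v, Rabs (u - t) < d -> Rabs (v - s) < d -> P u v).
  { intros t. destruct (classic (a <= t <= b)) as [Ht|Ht].
    - destruct (H t Ht) as [d Hd]. now exists d.
    (* The radius has to be a total function of [t]; outside [a, b] its value is arbitrary. *)
    - exists (mkposreal 1 Rlt_0_1). easy. }
  pose (d := fun t => proj1_sig (constructive_indefinite_description _ (C t))).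
  assert (Hd : forall t, a <= t <= b ->
    forall u v, Rabs (u - t) < d t -> Rabs (v - s) < d t -> P u v)
    by (intros t; exact (proj2_sig (constructive_indefinite_description _ (C t)))).
  destruct (compactness_value_1d a b d) as [e He].
  exists e. intros y Hy t Ht.
  (* [compactness_value_1d] provides the covering point only under a double negation. *)
  destruct (NNPP _ (He t Ht)) as (t' & Ht' & Hc & Hle).
  apply (Hd t' Ht'); [exact Hc|].
  change (Rabs (y - s) < e) in Hy. lra.
Qed.

Lemma continuity_2d_pt_swap (f : R -> R -> R) (x y : R) :
  continuity_2d_pt f x y -> continuity_2d_pt (fun u v => f v u) y x.
Proof.
  intros H eps. destruct (H eps) as [d Hd]. exists d. auto.
Qed.

(** To be used with the second and first [t]-derivatives of a variation as [A] and [B]. Smoothness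
    and nonvanishing of [B] are open conditions, so by the tube lemma they persist on all of [a, b]
    for parameters near [s]. *)
Lemma is_derive_RInt_quotient_sqr (A B : R -> R -> R) (a b s : R) :
  a <= b ->
  (forall t, a <= t <= b -> smooth2_at A t s) ->
  (forall t, a <= t <= b -> smooth2_at B t s) ->
  (forall t, a <= t <= b -> B t s <> 0) ->
  is_derive (fun y => RInt (fun t => (A t y / B t y) ^ 2) a b) s
    (RInt (fun t => 2 * (A t s / B t s) *
       ((d2 A t s * B t s - A t s * d2 B t s) / B t s ^ 2)) a b).
Proof.
  intros Hab HA HB HB0.
  pose (D := fun y t => 2 * (A t y / B t y) *
       ((d2 A t y * B t y - A t y * d2 B t y) / B t y ^ 2)).
  pose (good := fun t y => smooth2_at A t y /\ smooth2_at B t y /\ B t y <> 0).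
  assert (L : forall t, a <= t <= b -> locally_2d good t s).
  { intros t Ht. apply locally_2d_and; [now apply smooth2_at_locally, HA|].
    apply locally_2d_and; [now apply smooth2_at_locally, HB|].
    apply continuity_2d_pt_neq_0; auto using smooth2_at_continuity. }
  assert (Dgood : forall t y, good t y ->
    is_derive (fun z => (A t z / B t z) ^ 2) y (D y t)).
  { intros t y (At & Bt & B0). apply smooth2_at_ex_d2 in At, Bt.
    unfold D, d2. auto_derive; [easy|].
    change (fun x : R => A t x) with (A t). change (fun x : R => B t x) with (B t).
    now field. }
  assert (T := locally_2d_tube good a b s L).
  rewrite (RInt_ext _ (fun t => Derive (fun z => (A t z / B t z) ^ 2) s)).
  2: { rewrite Rmin_left, Rmax_right by easy. intros t Ht. symmetry.
    apply is_derive_unique, Dgood, locally_2d_singleton, L. lra. }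
  apply (is_derive_RInt_param (fun y t => (A t y / B t y) ^ 2)).
  - revert T. apply filter_imp. intros y Hy t.
    rewrite Rmin_left, Rmax_right by easy. intros Ht.
    exists (D y t). now apply Dgood, Hy.
  - intros t. rewrite Rmin_left, Rmax_right by easy. intros Ht.
    apply (continuity_2d_pt_swap (fun u v => Derive (fun z => (A u z / B u z) ^ 2) v)).
    apply continuity_2d_pt_ext_loc with (fun u v => D v u).
    { generalize (L t Ht). apply locally_2d_mono. intros u v Huv. symmetry.
      now apply is_derive_unique, Dgood. }
    specialize (HA t Ht). specialize (HB t Ht). specialize (HB0 t Ht).
    assert (CA := smooth2_at_continuity _ _ _ HA).
    assert (CB := smooth2_at_continuity _ _ _ HB).
    assert (CA2 := smooth2_at_continuity _ _ _ (smooth2_at_d2 _ _ _ HA)).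
    assert (CB2 := smooth2_at_continuity _ _ _ (smooth2_at_d2 _ _ _ HB)).
    (* Quotients and powers become products and inverses, the operations whose continuity is applied
       below. *)
    apply continuity_2d_pt_ext with (fun u v => 2 * (A u v * / B u v) *
       ((d2 A u v * B u v - A u v * d2 B u v) * / (B u v * B u v))).
    { intros. unfold D, Rdiv. do 3 f_equal. ring. }
    assert (B t s * B t s <> 0) by now apply Rmult_integral_contrapositive.
    repeat first [ assumption | apply continuity_2d_pt_const
      | apply continuity_2d_pt_inv | apply continuity_2d_pt_mult
      | apply continuity_2d_pt_minus ].
  - revert T. apply filter_imp. intros y Hy. apply (@ex_RInt_continuous R_CompleteNormedModule).
    intros t. rewrite Rmin_left, Rmax_right by easy. intros Ht.
    destruct (Hy t Ht) as (At & Bt & B0). apply smooth2_at_ex_d1 in At, Bt.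
    apply (ex_derive_continuous (fun t => (A t y / B t y) ^ 2)).
    now auto_derive.
Qed.

(** * The Euler-Lagrange expression and integration by parts *)

(** The difference of the two sides of the fourth order equation, multiplied by u'^3. Being
    polynomial in the derivatives, it is smooth wherever [u] is. *)
Definition EL_numerator (u : R -> R) (t : R) : R :=
  Derive_n u 4 t * Derive u t ^ 2
  - 4 * (Derive_n u 3 t * Derive_n u 2 t * Derive u t) + 3 * Derive_n u 2 t ^ 3.

Lemma EL_numerator_eq_0 (u : R -> R) (t : R) :
  Derive u t <> 0 -> EL_numerator u t = 0 <-> fourth_order_eq u t.
Proof.
  intros H. unfold fourth_order_eq.
  assert (E : EL_numerator u t / Derive u t ^ 3 = Derive_n u 4 t / Derive u t -
     (- 3 * ((Derive_n u 2 t) ^ 3 / (Derive u t) ^ 3)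
    + 4 * ((Derive_n u 3 t * Derive_n u 2 t) / (Derive u t) ^ 2)))
    by (unfold EL_numerator; now field).
  split; intros H0.
  - apply Rminus_diag_uniq. rewrite <- E, H0. now field.
  - rewrite H0, Rminus_diag in E.
    replace (EL_numerator u t) with (EL_numerator u t / Derive u t ^ 3 * Derive u t ^ 3)
      by now field.
    rewrite E. ring.
Qed.

Lemma smooth_at_EL_numerator (u : R -> R) (t : R) :
  smooth_at u t -> smooth_at (EL_numerator u) t.
Proof.
  intros H.
  apply (smooth_at_ext_loc (fun t => Derive_n u 4 t * Derive u t ^ 2
    + (-4 * (Derive_n u 3 t * Derive_n u 2 t * Derive u t) + 3 * Derive_n u 2 t ^ 3))).
  { apply filter_forall. intros y. unfold EL_numerator. ring. }
  assert (H1 := smooth_at_Derive u t H).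
  assert (H2 := smooth_at_Derive_n u 2 t H).
  assert (H3 := smooth_at_Derive_n u 3 t H).
  assert (H4 := smooth_at_Derive_n u 4 t H).
  revert H1 H2 H3 H4.
  generalize (Derive u), (Derive_n u 2), (Derive_n u 3), (Derive_n u 4).
  intros u1 u2 u3 u4 H1 H2 H3 H4.
  repeat match goal with
  | |- smooth_at (fun t => _ + _) _ => apply smooth_at_plus
  | |- smooth_at (fun t => _ * _) _ => apply smooth_at_mult
  | |- smooth_at (fun t => _ ^ _) _ => apply smooth_at_pow
  | |- smooth_at (fun t => ?c) _ => exact (smooth_at_const c _)
  end; assumption.
Qed.

Ltac derive_side :=
  simpl; repeat split; repeat apply Rmult_integral_contrapositive_currified;
  first [ exact I | assumption | exact R1_neq_R0 | eexists; eassumption ].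

(** The two integrands differ by the derivative of a function [W] that is linear in [v0] and [v1],
    hence zero at both ends. Successive derivatives are separate functions here, so that the
    identity behind it is one of rational functions. *)
Lemma RInt_by_parts_aux (u1 u2 u3 u4 v0 v1 v2 : R -> R) (a b : R) :
  a <= b ->
  (forall t, a <= t <= b -> u1 t <> 0) ->
  (forall t, a <= t <= b -> is_derive u1 t (u2 t) /\ is_derive u2 t (u3 t) /\
     is_derive u3 t (u4 t) /\ ex_derive u4 t) ->
  (forall t, a <= t <= b -> is_derive v0 t (v1 t) /\ is_derive v1 t (v2 t) /\
     ex_derive v2 t) ->
  v0 a = 0 -> v0 b = 0 -> v1 a = 0 -> v1 b = 0 ->
  RInt (fun t => 2 * (u2 t / u1 t) * ((v2 t * u1 t - u2 t * v1 t) / u1 t ^ 2)) a b =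
  RInt (fun t => 2 * (u4 t * u1 t ^ 2 - 4 * (u3 t * u2 t * u1 t) + 3 * u2 t ^ 3)
                 / u1 t ^ 4 * v0 t) a b.
Proof.
  intros Hab H1 Hu Hv a0 b0 a1 b1.
  pose (f := fun t => 2 * (u2 t / u1 t) * ((v2 t * u1 t - u2 t * v1 t) / u1 t ^ 2)).
  pose (g := fun t => 2 * (u4 t * u1 t ^ 2 - 4 * (u3 t * u2 t * u1 t) + 3 * u2 t ^ 3)
                 / u1 t ^ 4 * v0 t).
  (* [W = L_q v' - ((L_q)' - L_p) v] for [L = (q / p)^2], the boundary term of the
     two integrations by parts. *)
  pose (W := fun t => 2 * u2 t / u1 t ^ 2 * v1 t
     - (2 * u3 t / u1 t ^ 2 - 2 * u2 t ^ 2 / u1 t ^ 3) * v0 t).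
  change (RInt f a b = RInt g a b).
  assert (Cf : forall t, Rmin a b <= t <= Rmax a b -> continuous f t).
  { rewrite Rmin_left, Rmax_right by easy. intros t Ht.
    specialize (H1 t Ht). destruct (Hu t Ht) as (D1 & D2 & D3 & D4).
    destruct (Hv t Ht) as (E0 & E1 & E2).
    apply (ex_derive_continuous f). unfold f.
    auto_derive. derive_side. }
  assert (Cg : forall t, Rmin a b <= t <= Rmax a b -> continuous g t).
  { rewrite Rmin_left, Rmax_right by easy. intros t Ht.
    specialize (H1 t Ht). destruct (Hu t Ht) as (D1 & D2 & D3 & D4).
    destruct (Hv t Ht) as (E0 & E1 & E2).
    apply (ex_derive_continuous g). unfold g.
    auto_derive. derive_side. }
  assert (If := ex_RInt_continuous f a b Cf).
  assert (Ig := ex_RInt_continuous g a b Cg).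
  assert (Hd : is_RInt (fun t => minus (f t) (g t)) a b (minus (W b) (W a))).
  { apply (is_RInt_derive W).
    - rewrite Rmin_left, Rmax_right by easy. intros t Ht.
      specialize (H1 t Ht). destruct (Hu t Ht) as (D1 & D2 & D3 & D4).
      destruct (Hv t Ht) as (E0 & E1 & E2). unfold W.
      auto_derive; [derive_side|].
      change (fun x : R => u1 x) with u1. change (fun x : R => u2 x) with u2.
      change (fun x : R => u3 x) with u3. change (fun x : R => v0 x) with v0.
      change (fun x : R => v1 x) with v1.
      rewrite (is_derive_unique _ _ _ D1), (is_derive_unique _ _ _ D2),
        (is_derive_unique _ _ _ D3), (is_derive_unique _ _ _ E0),
        (is_derive_unique _ _ _ E1).
      unfold f, g, minus, plus, opp; simpl. now field.
    - intros t Ht. apply (continuous_minus f g); auto. }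
  assert (Hm := is_RInt_minus _ _ _ _ _ _ (RInt_correct _ _ _ If) (RInt_correct _ _ _ Ig)).
  (* The integral of [f - g] computed twice: by linearity and from the primitive [W]. *)
  assert (E := eq_trans (eq_sym (is_RInt_unique _ _ _ _ Hm)) (is_RInt_unique _ _ _ _ Hd)).
  unfold W, minus, plus, opp in E; simpl in E.
  rewrite a0, b0, a1, b1 in E.
  apply Rminus_diag_uniq. unfold Rminus. rewrite E. ring.
Qed.

Lemma smooth_at_is_derive_n (f : R -> R) (n : nat) (t : R) :
  smooth_at f t -> is_derive (Derive_n f n) t (Derive_n f (S n) t).
Proof.
  intros H. now apply (Derive_correct (Derive_n f n)), smooth_at_ex_derive, smooth_at_Derive_n.
Qed.

(** The open interval is dense in the closed one, and a nonzero value of [f] would persist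
    nearby. *)
Lemma continuous_eq_0_closure (f : R -> R) (a b : R) :
  a < b -> (forall t, a <= t <= b -> continuous f t) ->
  (forall t, a < t < b -> f t = 0) -> forall t, a <= t <= b -> f t = 0.
Proof.
  intros Hab Hc H0 t Ht. apply NNPP. intros Hn.
  assert (He : 0 < Rabs (f t)) by now apply Rabs_pos_lt.
  destruct (proj1 (filterlim_locally f (f t)) (Hc t Ht) (mkposreal _ He)) as [d Hd].
  assert (exists y, a < y < b /\ Rabs (y - t) < d) as (y & Hy & Hyt).
  (* Moving from [t] towards the farther end by at most a quarter of the length lands strictly
     inside (a, b). *)
  { assert (Hdp := cond_pos d). destruct (Rle_lt_dec t ((a + b) / 2)) as [Hm|Hm].
    - exists (t + Rmin (d / 2) ((b - a) / 4)).
      assert (0 < Rmin (d / 2) ((b - a) / 4)) by (apply Rmin_pos; lra).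
      assert (Hl := Rmin_l (d / 2) ((b - a) / 4)).
      assert (Hr := Rmin_r (d / 2) ((b - a) / 4)).
      split; [lra|]. rewrite Rabs_pos_eq; lra.
    - exists (t - Rmin (d / 2) ((b - a) / 4)).
      assert (0 < Rmin (d / 2) ((b - a) / 4)) by (apply Rmin_pos; lra).
      assert (Hl := Rmin_l (d / 2) ((b - a) / 4)).
      assert (Hr := Rmin_r (d / 2) ((b - a) / 4)).
      split; [lra|]. rewrite Rabs_left; lra. }
  specialize (Hd y Hyt). change (Rabs (f y - f t) < Rabs (f t)) in Hd.
  rewrite (H0 y Hy), Rminus_0_l, Rabs_Ropp in Hd. lra.
Qed.

(** * The first variation formula *)

Lemma first_variation (t0 t1 : R) (u : R -> R) (phi : R -> R -> R) :
  t0 < t1 -> smooth_on t0 t1 u -> (forall t, t0 <= t <= t1 -> Derive u t <> 0) ->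
  variation t0 t1 u phi -> fixed_to_first_order t0 t1 (variational_field phi) ->
  is_derive (fun s => action t0 t1 Lag (fun t => phi t s)) 0
    (RInt (fun t => 2 * EL_numerator u t / Derive u t ^ 4 * variational_field phi t) t0 t1).
Proof.
  intros ht hu hu' [Hphi Hu] (a0 & b0 & a1 & b1).
  assert (Sphi : forall t, t0 <= t <= t1 -> smooth2_at phi t 0)
    by (intros t Ht; apply Hphi; lra).
  set (g := fun t => phi t 0). set (v := variational_field phi) in *.
  assert (Sg : forall t, t0 <= t <= t1 -> smooth_at g t)
    by (intros t Ht; now apply smooth2_at_slice, Sphi).
  assert (Sv : forall t, t0 <= t <= t1 -> smooth_at v t)
    by (intros t Ht; now apply (smooth2_at_slice (d2 phi)), smooth2_at_d2, Sphi).
  (* [g] and [u] need not agree outside [t0, t1], so at the endpoints their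
     derivatives are compared by continuity. *)
  assert (Dg : forall n t, t0 <= t <= t1 -> Derive_n g n t = Derive_n u n t).
  { intros n.
    assert (Hin : forall t, t0 < t < t1 -> Derive_n g n t - Derive_n u n t = 0).
    { intros t Ht. apply Rminus_diag_eq, Derive_n_ext_loc.
      apply (locally_interval _ t t0 t1); try apply Ht.
      intros y Hy0 Hy1. apply Hu. simpl in Hy0, Hy1. lra. }
    intros t Ht. apply Rminus_diag_uniq.
    apply (continuous_eq_0_closure (fun t => Derive_n g n t - Derive_n u n t) t0 t1);
      auto.
    clear t Ht. intros t Ht.
    apply (continuous_minus (Derive_n g n) (Derive_n u n));
      apply smooth_at_continuous, smooth_at_Derive_n; [now apply Sg|now apply hu]. }
  assert (g' : forall t, t0 <= t <= t1 -> Derive g t <> 0).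
  { intros t Ht. change (Derive_n g 1 t <> 0). rewrite Dg by easy. now apply hu'. }
  evar_last.
  (* Along the variation, u'' and u' become [d1 (d1 phi)] and [d1 phi]. *)
  - apply (is_derive_RInt_quotient_sqr (d1 (d1 phi)) (d1 phi) t0 t1 0).
    + lra.
    + intros t Ht. now apply smooth2_at_d1, smooth2_at_d1, Sphi.
    + intros t Ht. now apply smooth2_at_d1, Sphi.
    + exact g'.
  - transitivity (RInt (fun t => 2 * EL_numerator g t / Derive g t ^ 4 * v t) t0 t1).
    + refine (eq_trans _ (RInt_by_parts_aux (Derive g) (Derive_n g 2) (Derive_n g 3)
        (Derive_n g 4) v (Derive v) (Derive_n v 2) t0 t1 (Rlt_le _ _ ht) g' _ _
        a0 b0 a1 b1)).
      * apply RInt_ext. rewrite Rmin_left, Rmax_right by lra. intros t Ht.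
        assert (St : smooth2_at phi t 0) by (apply Sphi; lra).
        (* Mixed partials commute, so the [s]-derivatives of the first and second [t]-derivatives of
           [phi] are v' and v''. For v'' the exchange is made twice, the second time on a
           neighbourhood of [t]. *)
        assert (E1 : d2 (d1 phi) t 0 = Derive v t)
          by now rewrite <- smooth2_at_Schwarz.
        assert (E2 : d2 (d1 (d1 phi)) t 0 = Derive_n v 2 t).
        { rewrite <- smooth2_at_Schwarz by now apply smooth2_at_d1.
          apply Derive_ext_loc.
          generalize (locally_2d_1d_const_y _ _ _ (smooth2_at_locally _ _ _ St)).
          apply filter_imp. intros y Hy. now rewrite <- smooth2_at_Schwarz. }
        now rewrite E1, E2.
      * intros t Ht. specialize (Sg t Ht). split; [|split; [|split]].
        -- exact (smooth_at_is_derive_n g 1 t Sg).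
        -- exact (smooth_at_is_derive_n g 2 t Sg).
        -- exact (smooth_at_is_derive_n g 3 t Sg).
        -- eexists. exact (smooth_at_is_derive_n g 4 t Sg).
      * intros t Ht. specialize (Sv t Ht). split; [|split].
        -- exact (smooth_at_is_derive_n v 0 t Sv).
        -- exact (smooth_at_is_derive_n v 1 t Sv).
        -- eexists. exact (smooth_at_is_derive_n v 2 t Sv).
    + apply RInt_ext. rewrite Rmin_left, Rmax_right by lra. intros t Ht.
      unfold EL_numerator. change (Derive g t) with (Derive_n g 1 t).
      now rewrite !Dg by lra.
Qed.

(** * From vanishing variation to the equation *)

(** The integrals over [a, x] and [x, b] are nonnegative with sum zero, so the primitive of [f] from
    [a] is constantly zero, and its derivative is [f]. *)
Lemma continuous_nonneg_RInt_eq_0 (f : R -> R) (a b : R) :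
  a < b -> (forall t, a <= t <= b -> continuous f t) ->
  (forall t, a < t < b -> 0 <= f t) -> RInt f a b = 0 ->
  forall t, a < t < b -> f t = 0.
Proof.
  intros Hab Hc Hf H0.
  assert (I : forall x y, a <= x -> x <= y -> y <= b -> ex_RInt f x y).
  { intros x y Hx Hxy Hy. apply (@ex_RInt_continuous R_CompleteNormedModule).
    rewrite Rmin_left, Rmax_right by lra. intros t Ht. apply Hc. lra. }
  assert (F0 : forall x, a < x < b -> RInt f a x = 0).
  { intros x Hx.
    assert (E := RInt_Chasles f a x b (I a x ltac:(lra) ltac:(lra) ltac:(lra))
      (I x b ltac:(lra) ltac:(lra) ltac:(lra))).
    rewrite H0 in E. unfold plus in E; simpl in E.
    assert (0 <= RInt f a x) by (apply RInt_ge_0; [lra|apply I; lra|intros; apply Hf; lra]).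
    assert (0 <= RInt f x b) by (apply RInt_ge_0; [lra|apply I; lra|intros; apply Hf; lra]).
    lra. }
  intros t Ht.
  assert (L : forall P : R -> Prop, (forall y, a < y < b -> P y) -> locally t P).
  { intros P HP. apply (locally_interval _ t a b); try apply Ht.
    intros y Hy0 Hy1. apply HP. simpl in Hy0, Hy1. lra. }
  assert (D : is_derive (fun x => RInt f a x) t (f t)).
  { apply (is_derive_RInt f _ a); [|apply Hc; lra].
    apply L. intros y Hy. apply (RInt_correct f), I; lra. }
  apply is_derive_unique in D. rewrite <- D.
  rewrite (Derive_ext_loc _ (fun _ => 0)); [apply Derive_const|]. now apply L.
Qed.

Theorem theorem2p1 (t0 t1 : R) (u : R -> R)
    (ht : t0 < t1)
    (hu : smooth_on t0 t1 u)
    (hu' : forall t, t0 <= t <= t1 -> Derive u t <> 0) :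
  (critical_point t0 t1 (action t0 t1 Lag) (fixed_to_first_order t0 t1) u <->
   (forall t, t0 <= t <= t1 -> fourth_order_eq u t))
  /\
  ((forall t, t0 <= t <= t1 -> schwarzian u t = 0) ->
   (forall t, t0 <= t <= t1 -> fourth_order_eq u t)).
Proof.
  (* Both implications that end in the equation are argued at interior points only; continuity of
     [EL_numerator u] supplies the endpoints. *)
  assert (closing : (forall t, t0 < t < t1 -> EL_numerator u t = 0) ->
    forall t, t0 <= t <= t1 -> fourth_order_eq u t).
  { intros H t Ht. apply EL_numerator_eq_0; [now apply hu'|].
    apply (continuous_eq_0_closure _ t0 t1 ht); auto.
    intros x Hx. now apply smooth_at_continuous, smooth_at_EL_numerator, hu. }
  split; [split|].
  - intros Hcrit. apply closing.
    (* The double zeros at [t0] and [t1] make both [eta] and its derivative vanish there, while [w]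
       is positive in between. *)
    set (w := fun t => (t - t0) ^ 2 * (t1 - t) ^ 2).
    set (eta := fun t => w t * EL_numerator u t).
    assert (Seta : forall t, t0 <= t <= t1 -> smooth_at eta t).
    { intros t Ht. apply smooth_at_mult; [|now apply smooth_at_EL_numerator, hu].
      apply smooth_at_mult; apply smooth_at_pow.
      - apply smooth_at_plus; [apply smooth_at_id|apply smooth_at_const].
      - apply (smooth_at_ext_loc (fun t => t1 + -1 * t)).
        { apply filter_forall. intros y. ring. }
        apply smooth_at_plus; [apply smooth_at_const|].
        apply smooth_at_mult; [apply smooth_at_const|apply smooth_at_id]. }
    set (phi := fun t s => u t + s * eta t).
    assert (Hphi : variation t0 t1 u phi).
    { split.
      - intros t s Ht _. now apply smooth2_at_affine; [apply hu|apply Seta].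
      - intros t _. unfold phi. ring. }
    assert (Hv : forall t, variational_field phi t = eta t).
    { intros t. apply is_derive_unique. unfold phi. auto_derive; [easy|ring]. }
    assert (Hfix : fixed_to_first_order t0 t1 (variational_field phi)).
    { assert (D : forall t, t0 <= t <= t1 -> Derive (variational_field phi) t =
        (2 * (t - t0) * (t1 - t) ^ 2 - 2 * (t - t0) ^ 2 * (t1 - t)) * EL_numerator u t
        + w t * Derive (EL_numerator u) t).
      { intros t Ht. rewrite (Derive_ext _ _ _ Hv). apply is_derive_unique.
        assert (E : ex_derive (EL_numerator u) t)
          by now apply smooth_at_ex_derive, smooth_at_EL_numerator, hu.
        unfold eta, w. auto_derive; [easy|].
        change (fun x : R => EL_numerator u x) with (EL_numerator u). ring. }
      unfold fixed_to_first_order. rewrite !Hv, !D by lra.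
      unfold eta, w. repeat split; ring. }
    assert (D0 := Hcrit phi Hphi Hfix).
    assert (D1 := first_variation t0 t1 u phi ht hu hu' Hphi Hfix).
    apply is_derive_unique in D0, D1. rewrite D0 in D1. symmetry in D1.
    (* The integrand of the first variation along [eta], written as a positive multiple of [w] times
       a square. *)
    set (q := fun t => 2 * w t * (EL_numerator u t / Derive u t ^ 2) ^ 2).
    assert (Q0 : forall t, t0 < t < t1 -> q t = 0).
    { apply continuous_nonneg_RInt_eq_0; [easy| | |].
      - intros t Ht. apply (ex_derive_continuous q).
        assert (E : ex_derive (EL_numerator u) t)
          by now apply smooth_at_ex_derive, smooth_at_EL_numerator, hu.
        assert (E1 : ex_derive (Derive u) t)
          by now apply smooth_at_ex_derive, smooth_at_Derive, hu.
        unfold q, w. auto_derive.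
        specialize (hu' t Ht). derive_side.
      - intros t Ht. unfold q, w.
        apply Rmult_le_pos; [|apply pow2_ge_0].
        apply Rmult_le_pos; [lra|apply Rmult_le_pos; apply pow2_ge_0].
      - rewrite <- D1. apply RInt_ext. rewrite Rmin_left, Rmax_right by lra.
        intros t Ht. rewrite Hv.
        match goal with |- ?x = ?y => change (@eq R x y) end.
        unfold q, eta. assert (Derive u t <> 0) by (apply hu'; lra). now field. }
    intros t Ht. specialize (Q0 t Ht).
    assert (Derive u t <> 0) by (apply hu'; lra).
    assert (W0 : 0 < w t) by (apply Rmult_lt_0_compat; apply pow_lt; lra).
    apply Rmult_integral in Q0. destruct Q0 as [Q0|Q0]; [lra|].
    assert (Q1 : EL_numerator u t / Derive u t ^ 2 = 0)
      by (apply Rsqr_0_uniq; unfold Rsqr; lra).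
    replace (EL_numerator u t) with (EL_numerator u t / Derive u t ^ 2 * Derive u t ^ 2)
      by now field.
    rewrite Q1. ring.
  - intros H phi Hphi Hfix.
    evar_last; [now apply (first_variation t0 t1 u phi)|].
    rewrite (RInt_ext _ (fun _ => 0)).
    + rewrite RInt_const. apply Rmult_0_r.
    + rewrite Rmin_left, Rmax_right by lra. intros t Ht.
      assert (E : EL_numerator u t = 0)
        by (apply EL_numerator_eq_0; [apply hu'|apply H]; lra).
      rewrite E. unfold Rdiv. now rewrite Rmult_0_r, !Rmult_0_l.
  - intros H. apply closing. intros t Ht.
    assert (Su : smooth_at u t) by (apply hu; lra).
    assert (u1 : Derive u t <> 0) by (apply hu'; lra).
    assert (D : is_derive (schwarzian u) t (EL_numerator u t / Derive u t ^ 3)).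
    { assert (D1 := smooth_at_is_derive_n u 1 t Su).
      assert (D2 := smooth_at_is_derive_n u 2 t Su).
      assert (D3 := smooth_at_is_derive_n u 3 t Su).
      change (Derive_n u 1) with (Derive u) in D1.
      unfold EL_numerator, schwarzian. revert D1 D2 D3 u1.
      generalize (Derive u), (Derive_n u 2), (Derive_n u 3), (Derive_n u 4).
      intros f1 f2 f3 f4 D1 D2 D3 u1.
      auto_derive; [derive_side|].
      change (fun x : R => f1 x) with f1. change (fun x : R => f2 x) with f2.
        change (fun x : R => f3 x) with f3.
        rewrite (is_derive_unique _ _ _ D1), (is_derive_unique _ _ _ D2),
          (is_derive_unique _ _ _ D3). now field. }
    apply is_derive_unique in D.
    (* At an interior point the Schwarzian vanishes on a whole neighbourhood, so its derivative is
       zero there. *)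
    rewrite (Derive_ext_loc _ (fun _ => 0)), Derive_const in D.
    + replace (EL_numerator u t) with (EL_numerator u t / Derive u t ^ 3 * Derive u t ^ 3)
        by now field.
      rewrite <- D. ring.
    + apply (locally_interval _ t t0 t1); try apply Ht.
      intros y Hy0 Hy1. apply H. simpl in Hy0, Hy1. lra.
Qed.
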